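(* Let $L \in \mathbb{R}^{n\times n}$ be the combinatorial directed Laplacian of a directed weighted graph on $n$ vertices, and suppose $L = V\Lambda V^{-1}$ with $V\in\mathbb{C}^{n\times n}$ invertible and $\Lambda=\operatorname{diag}(\lambda_1,\dots,\lambda_n)$, $\lambda_k\in\mathbb{C}$. Let $\sigma_{\min}(V)$ and $\sigma_{\max}(V)$ denote the smallest and largest singular values of $V$. Then for every $x=V\hat{x}$ with $\hat{x}=(\hat{x}_1,\dots,\hat{x}_n)\in\mathbb{C}^n$, $$\sigma_{\min}^2(V)\sum_{k=1}^{n}|\lambda_k|^2|\hat{x}_k|^2 \;\le\; \|Lx\|_2^2 \;\le\; \sigma_{\max}^2(V)\sum_{k=1}^{n}|\lambda_k|^2|\hat{x}_k|^2.$$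
   Context: Directed Laplacian: for a directed weighted graph on vertex set $\{1,\dots,n\}$ with real edge weights $w(i,j)$, the adjacency matrix $A\in\mathbb{R}^{n\times n}$ has $A_{ij}=w(i,j)$ if $(i,j)$ is an edge (oriented $i\to j$) and $A_{ij}=0$ otherwise; the out-degrees are $d_i^{\mathrm{out}}=\sum_{j=1}^n A_{ij}$, $D_{\mathrm{out}}=\operatorname{diag}(d_1^{\mathrm{out}},\dots,d_n^{\mathrm{out}})$, and $L := D_{\mathrm{out}}-A$. The columns of $V$ are right eigenvectors of $L$ (not necessarily orthogonal or normalized), and $\hat{x}=V^{-1}x$ is the vector of BGFT (Biorthogonal Graph Fourier Transform) coefficients of $x$. The quantity $\|Lx\|_2^2 = x^*L^*Lx$ is the directed total variation $TV_G(x)$ of the signal $x$; $\|\cdot\|_2$ is the Euclidean norm. *)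

(* Defs.v *)
From HB Require Import structures.
From mathcomp Require Import all_boot all_order all_algebra.
From mathcomp Require Import reals.
From mathcomp Require Import complex.
Set Implicit Arguments.
Unset Strict Implicit.
Unset Printing Implicit Defensive.
Import Order.TTheory GRing.Theory Num.Theory.
Local Open Scope ring_scope.
Local Open Scope complex_scope.
Local Open Scope sesquilinear_scope.

(* Weights are arbitrary reals (possibly negative or zero), and self-loops are
   allowed. *)
Record wdigraph (R : realType) (n : nat) := WDigraph {
  edge : rel 'I_n;
  weight : 'I_n -> 'I_n -> R }.

Definition adjacency (R : realType) (n : nat) (G : wdigraph R n) : 'M[R]_n :=
  \matrix_(i, j) if edge G i j then weight G i j else 0.

Definition out_degree (R : realType) (n : nat) (G : wdigraph R n) : 'rV[R]_n :=
  \row_i \sum_j adjacency G i j.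

Definition laplacian (R : realType) (n : nat) (G : wdigraph R n) : 'M[R]_n :=
  diag_mx (out_degree G) - adjacency G.

Definition complexmx (R : realType) (m n : nat) (A : 'M[R]_(m, n)) :
  'M[R[i]]_(m, n) := map_mx (real_complex R) A.

Definition cabs (R : realType) (z : R[i]) : R := Normc.normc z.

Definition l2norm (R : realType) (n : nat) (x : 'cV[R[i]]_n) : R :=
  Num.sqrt (\sum_i cabs (x i 0) ^+ 2).

(* Eigenvalues are listed with algebraic multiplicity, in no particular order;
   char_poly is monic, so the lemmas below characterize the list. *)
Definition eigenvalues (C : closedFieldType) (n : nat) (A : 'M[C]_n) : seq C :=
  sval (closed_field_poly_normal (char_poly A)).

Lemma char_poly_eigenvalues (C : closedFieldType) (n : nat) (A : 'M[C]_n) :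
  char_poly A = \prod_(a <- eigenvalues A) ('X - a%:P).
Proof.
rewrite /eigenvalues; case: closed_field_poly_normal => s /= {1}->.
by rewrite (monicP (char_poly_monic A)) scale1r.
Qed.

Lemma mem_eigenvalues (C : closedFieldType) (n : nat) (A : 'M[C]_n) (a : C) :
  (a \in eigenvalues A) = eigenvalue A a.
Proof.
by rewrite eigenvalue_root_char char_poly_eigenvalues root_prod_XsubC.
Qed.

(* The eigenvalues of V^* V are real and nonnegative, so taking Re only changes
   their type from R[i] to R.  The list is in nonincreasing order, with
   multiplicity; the default 0 of head and last is only reached for n = 0. *)
Definition singular_values (R : realType) (n : nat) (V : 'M[R[i]]_n) : seq R :=
  sort >=%R [seq Num.sqrt (complex.Re a) | a <- eigenvalues (V^t* *m V)].

Definition sigma_max (R : realType) (n : nat) (V : 'M[R[i]]_n) : R :=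
  head 0 (singular_values V).

Definition sigma_min (R : realType) (n : nat) (V : 'M[R[i]]_n) : R :=
  last 0 (singular_values V).

(* Main.v *)
(* Diagonalize the Gram matrix of [V] as [V^* V = P^* diag(s) P] with [P]
   unitary.  Then [|V y|^2 = sum_i s_i |(P y)_i|^2] and [|P y| = |y|], while every
   [s_i] is the square of a singular value of [V]; hence
   [sigma_min |y| <= |V y| <= sigma_max |y|].  The theorem is the case
   [y = diag(lambda) xhat], since [L x = V y]. *)
Require Import Defs.
From mathcomp Require Import all_boot all_order all_algebra.
From mathcomp Require Import reals complex.
Import Order.TTheory GRing.Theory Num.Theory.
Local Open Scope ring_scope.
Local Open Scope complex_scope.
Local Open Scope sesquilinear_scope.

Lemma cabsE (R : realType) (z : R[i]) : (cabs z)%:C = `|z|.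
Proof. by case: z. Qed.

Lemma cabsM (R : realType) : {morph @cabs R : a b / a * b}.
Proof. by move=> a b; apply: Normc.normcM. Qed.

Lemma l2norm_sqr (R : realType) (n : nat) (y : 'cV[R[i]]_n) :
  l2norm y ^+ 2 = \sum_i cabs (y i 0) ^+ 2.
Proof. by rewrite sqr_sqrtr// sumr_ge0// => i _; rewrite sqr_ge0. Qed.

(** Moves squared norms into [R[i]], where they can be handled by matrix algebra; [complexI] brings
    the resulting identities back to [R]. *)
Lemma l2norm_sqrC (R : realType) (n : nat) (y : 'cV[R[i]]_n) :
  (l2norm y ^+ 2)%:C = (y^t* *m y) 0 0.
Proof.
rewrite l2norm_sqr rmorph_sum mxE; apply: eq_bigr => i _ /=.
by rewrite !mxE rmorphXn /= cabsE normCK mulrC.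
Qed.

Lemma l2norm_unitary (R : realType) (n : nat) (P : 'M[R[i]]_n)
    (y : 'cV[R[i]]_n) :
  P \is unitarymx -> l2norm (P *m y) ^+ 2 = l2norm y ^+ 2.
Proof.
move=> Pu; apply: complexI; rewrite !l2norm_sqrC trmx_mul map_mxM.
rewrite -mulmxA (mulmxA (P^t*)) -invmx_unitary//.
by rewrite mulVmx ?unitarymx_unit// mul1mx.
Qed.

Lemma gram_normal (C : numClosedFieldType) (m n : nat) (V : 'M[C]_(m, n)) :
  V^t* *m V \is normalmx.
Proof. by apply/normalmxP; rewrite trmx_mul map_mxM trmxCK. Qed.

(** Here [eigenvalue] refers to row vectors. From [A = P^-1 diag(s) P] follows [P A = diag(s) P], so
    row [i] of [P] is a left eigenvector for [s_i]. *)
Lemma eigenvalue_spectral_diag (C : numClosedFieldType) (n : nat) (A : 'M[C]_n)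
    (i : 'I_n) :
  A \is normalmx -> eigenvalue A (spectral_diag A 0 i).
Proof.
move=> /orthomx_spectralP A_eq; have Pu := spectral_unit A.
apply/eigenvalueP; exists (row i (spectralmx A)); last first.
  (* If row [i] of [P] vanished, so would row [i] of [P B = 1], whose diagonal entry is 1. *)
  move: Pu; rewrite -row_free_unit => /row_freeP[B PB1].
  apply/eqP => /(congr1 (mulmx^~ B)); rewrite -row_mul PB1 mul0mx.
  by move=> /rowP/(_ i)/eqP; rewrite !mxE eqxx oner_eq0.
rewrite {2}A_eq -row_mul !mulmxA mulmxV// mul1mx.
by apply/rowP => j; rewrite mul_diag_mx !mxE.
Qed.

(** Since [P^-1 = P^*], the form [y^* V^* V y] regroups as [(P y)^* diag(s) (P y)]. *)
Lemma l2norm_mul_spectral (R : realType) (n : nat) (V : 'M[R[i]]_n)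
    (y : 'cV[R[i]]_n) :
  (l2norm (V *m y) ^+ 2)%:C =
  \sum_i spectral_diag (V^t* *m V) 0 i *
         `|(spectralmx (V^t* *m V) *m y) i 0| ^+ 2.
Proof.
have Pu := spectral_unitarymx (V^t* *m V).
have /orthomx_spectralP V_eq := gram_normal _ _ _ V.
rewrite l2norm_sqrC trmx_mul map_mxM -mulmxA (mulmxA (V^t*)) {1}V_eq.
rewrite invmx_unitary// -!mulmxA mulmxA -map_mxM -trmx_mul mxE.
by apply: eq_bigr => i _; rewrite mul_diag_mx !mxE normCK mulrCA [_^* * _]mulrC.
Qed.

Lemma spectral_diag_gram_ge0 (R : realType) (n : nat) (V : 'M[R[i]]_n)
    (i : 'I_n) :
  0 <= spectral_diag (V^t* *m V) 0 i.
Proof.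
have Pu := spectral_unitarymx (V^t* *m V).
(* With [y = P^* e_i] one has [P y = e_i], so the sum collapses to its [i]-th term and [s_i] equals
   [|V y|^2]. *)
have := l2norm_mul_spectral _ _ V ((spectralmx (V^t* *m V))^t* *m delta_mx i 0).
rewrite mulmxA (unitarymxP Pu) mul1mx (bigD1 i)//= big1 => [|j ji].
  by rewrite mxE !eqxx normr1 expr1n mulr1 addr0 => <-; rewrite ler0c sqr_ge0.
by rewrite mxE (negPf ji) normr0 expr0n mulr0.
Qed.

Lemma singular_values_sorted (R : realType) (n : nat) (V : 'M[R[i]]_n) :
  sorted >=%R (singular_values V).
Proof. by apply: sort_sorted => a b; rewrite orbC; apply: le_total. Qed.

Lemma sigma_min_max (R : realType) (n : nat) (V : 'M[R[i]]_n) (a : R) :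
  a \in singular_values V -> sigma_min V <= a <= sigma_max V.
Proof.
rewrite /sigma_min /sigma_max; move: (singular_values_sorted _ _ V).
have ge_tr : transitive (>=%R : rel R) by move=> x y z xy /le_trans; apply.
case: (singular_values V) => //= b s; rewrite (path_sortedE ge_tr) => /andP[hb].
move=> ss abs; apply/andP; split; last first.
  by move: abs; rewrite inE => /orP[/eqP->|/(allP hb)].
(* The head [b] is generalized because the last entry of [b :: c :: s] is that of [c :: s]. When
   [a = b], the bound passes through [c]: last entry [<= c <= b]. *)
elim: s a b hb ss abs => [|c s IHs] a b /=; first by rewrite inE => _ _ /eqP->.
rewrite (path_sortedE ge_tr) => /andP[cb _] /andP[hc ss].
rewrite inE => /orP[/eqP->|]; last exact: IHs.
by apply: le_trans cb; apply: IHs => //; rewrite mem_head.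
Qed.

Lemma sigma_min_ge0 (R : realType) (n : nat) (V : 'M[R[i]]_n) :
  0 <= sigma_min V.
Proof.
have : all (>= 0) (singular_values V).
  by rewrite all_sort; apply/allP => _ /mapP[a _ ->]; rewrite sqrtr_ge0.
rewrite /sigma_min; case: (singular_values V) => // b s /allP; apply.
by rewrite /= mem_last.
Qed.

(** Each [s_i] is an eigenvalue of the Gram matrix, so its square root occurs among the singular
    values; squaring the bounds on that root is monotone because all three terms are nonnegative. *)
Lemma sigma_bounds_spectral_diag (R : realType) (n : nat) (V : 'M[R[i]]_n)
    (i : 'I_n) (s := complex.Re (spectral_diag (V^t* *m V) 0 i)) :
  sigma_min V ^+ 2 <= s <= sigma_max V ^+ 2.
Proof.
have s_ge0 : 0 <= s.
  by rewrite -ler0c RRe_real ?ger0_real ?spectral_diag_gram_ge0.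
have /sigma_min_max/andP[mins smax] : Num.sqrt s \in singular_values V.
  rewrite mem_sort; apply/mapP; exists (spectral_diag (V^t* *m V) 0 i) => //.
  rewrite mem_eigenvalues; exact/eigenvalue_spectral_diag/gram_normal.
(* The index [i] supplies a singular value, a square root, below [sigma_max V], which is therefore
   nonnegative. *)
have max_ge0 := le_trans (sqrtr_ge0 s) smax.
by rewrite -(sqr_sqrtr s_ge0) !lerXn2r ?nnegrE ?sqrtr_ge0 ?sigma_min_ge0 ?mins.
Qed.

Lemma sigma_bounds (R : realType) (n : nat) (V : 'M[R[i]]_n)
    (y : 'cV[R[i]]_n) :
  sigma_min V ^+ 2 * l2norm y ^+ 2 <= l2norm (V *m y) ^+ 2
    <= sigma_max V ^+ 2 * l2norm y ^+ 2.
Proof.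
set P := spectralmx (V^t* *m V).
have -> : l2norm (V *m y) ^+ 2 =
    \sum_i complex.Re (spectral_diag (V^t* *m V) 0 i) *
           cabs ((P *m y) i 0) ^+ 2.
  apply: complexI; rewrite l2norm_mul_spectral rmorph_sum; apply: eq_bigr => i _.
  rewrite rmorphM rmorphXn /= cabsE.
  by rewrite RRe_real ?ger0_real ?spectral_diag_gram_ge0.
(* Replacing [|y|] by [|P y|] turns all three quantities into weighted sums of the same
   [|(P y)_i|^2], so the weights can be compared term by term. *)
rewrite -(l2norm_unitary _ _ _ y (spectral_unitarymx (V^t* *m V))) l2norm_sqr.
rewrite !mulr_sumr; apply/andP; split; apply: ler_sum => i _;
  by rewrite ler_wpM2r ?sqr_ge0//; case/andP: (sigma_bounds_spectral_diag _ _ V i).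
Qed.

Theorem theorem4p2 (R : realType) (n : nat) (G : wdigraph R n)
    (V : 'M[R[i]]_n) (lambda : 'rV[R[i]]_n)
    (V_unit : V \in unitmx)
    (L_diag : complexmx (laplacian G) = V *m diag_mx lambda *m invmx V)
    (x xhat : 'cV[R[i]]_n) (x_def : x = V *m xhat) :
  sigma_min V ^+ 2 * (\sum_(k < n) cabs (lambda 0 k) ^+ 2 * cabs (xhat k 0) ^+ 2)
    <= l2norm (complexmx (laplacian G) *m x) ^+ 2
  /\
  l2norm (complexmx (laplacian G) *m x) ^+ 2
    <= sigma_max V ^+ 2 * (\sum_(k < n) cabs (lambda 0 k) ^+ 2 * cabs (xhat k 0) ^+ 2).
Proof.
have -> : complexmx (laplacian G) *m x = V *m (diag_mx lambda *m xhat).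
  by rewrite x_def L_diag -!mulmxA mulKmx.
have -> : \sum_(k < n) cabs (lambda 0 k) ^+ 2 * cabs (xhat k 0) ^+ 2 =
    l2norm (diag_mx lambda *m xhat) ^+ 2.
  rewrite l2norm_sqr; apply: eq_bigr => k _.
  by rewrite mul_diag_mx mxE cabsM exprMn.
exact/andP/sigma_bounds.
Qed.
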